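(* The group $\mathrm{PGL}(2,5)$, viewed as a subgroup of $\mathrm{Sym}_6$ via its action on the $6$ projective points, is a perfect code in the Star graph $S_6$. Moreover, the partition of $\mathrm{Sym}_6$ into the left cosets $\pi\,\mathrm{PGL}(2,5)$ and the partition of $\mathrm{Sym}_6$ into the right cosets $\mathrm{PGL}(2,5)\,\pi$ ($\pi\in\mathrm{Sym}_6$) are both partitions of the vertex set of $S_6$ into perfect codes.
   Context: $\mathrm{Sym}_n$ is the symmetric group on $\{1,\ldots,n\}$. For a group $G$ with an inverse-closed generating set $H$ not containing the identity, the Cayley graph $\Gamma(G,H)$ has vertex set $G$ and edge set $\{(hg,g): g\in G,\ h\in H\}$. The Star graph is $S_n=\Gamma(\mathrm{Sym}_n,\{(1\ i):2\le i\le n\})$; it is $(n-1)$-regular. A code in a graph is a subset $C$ of its vertices; its minimum distance is $\min_{x,y\in C,\,x\ne y}d(x,y)$, where $d$ is the graph distance. A code $C$ in a $k$-regular graph with vertex set $V$ is perfect if its minimum distance is $3$ and $|C|=|V|/(k+1)$. $\mathrm{PGL}(2,5)$ is the projective linear group induced by the action of $\mathrm{GL}(2,5)$ on the six $1$-dimensional subspaces (projective points) of a $2$-dimensional vector space over the field with $5$ elements. The projective points are enumerated (by an arbitrary fixed bijection) by the elements of $\{1,\ldots,6\}$, so $\mathrm{PGL}(2,5)$ is a subgroup of $\mathrm{Sym}_6$. *)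

(* Defs.v *)
From HB Require Import structures.
From mathcomp Require Import all_boot all_order all_fingroup all_algebra.

Set Implicit Arguments.
Unset Strict Implicit.
Unset Printing Implicit Defensive.

Import GroupScope.

(* A graph on a finite vertex set is given by its adjacency relation. *)
Section Codes.
Variables (V : finType) (e : rel V).

(* Stated as a relation so that no value has to be assigned to vertices in
   different connected components (for these, [is_gdist] holds for no d). *)
Definition is_gdist (x y : V) (d : nat) : Prop :=
  (exists p : seq V, [/\ path e x p, last x p = y & size p = d]) /\
  (forall p : seq V, path e x p -> last x p = y -> (d <= size p)%N).

Definition is_min_distance (C : {set V}) (d : nat) : Prop :=
  (exists x y : V, [/\ x \in C, y \in C, x != y & is_gdist x y d]) /\
  (forall (x y : V) (d' : nat),
     x \in C -> y \in C -> x != y -> is_gdist x y d' -> (d <= d')%N).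

Definition regular_graph (k : nat) : Prop :=
  forall x : V, #|[set y | e x y]| = k.

Definition perfect_code (C : {set V}) : Prop :=
  exists k : nat,
    [/\ regular_graph k, is_min_distance C 3
      & (#|C|%:R = #|V|%:R / k.+1%:R :> rat)%R].

Definition perfect_code_partition (P : {set {set V}}) : Prop :=
  partition P [set: V] /\ (forall C : {set V}, C \in P -> perfect_code C).

End Codes.

Definition cayley_graph (gT : finGroupType) (H : {set gT}) : rel gT :=
  [rel x y | [exists h in H, x == h * y]].

(* The letters 1, ..., n are represented by 0, ..., n-1 in 'I_n.
   The product s * t of permutations applies s first and then t. With the
   opposite convention the graph becomes {(g * h, g)} and the two kinds of
   cosets are exchanged; inversion fixes every transposition and every subgroup
   and carries one setting to the other. *)
Definition star_generators (n : nat) : {set 'S_n} :=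
  [set tperm i j | i in [set i : 'I_n | i == 0%N :> nat],
                   j in [set j : 'I_n | j != 0%N :> nat]].

Definition star_graph (n : nat) : rel 'S_n := cayley_graph (star_generators n).
Arguments star_graph n : clear implicits.

Definition proj_point : Type := {U : {vspace 'cV['F_5]_2} | \dim U == 1%N}.

Definition gl_image (g : {'GL_2(5)}) (U : {vspace 'cV['F_5]_2}) :
    {vspace 'cV['F_5]_2} :=
  (linfun (mulmx (GLval g : 'M['F_5]_2) : 'cV['F_5]_2 -> 'cV['F_5]_2) @: U)%VS.

(* The permutations of 'I_6 induced by GL(2,5) when the projective points are
   labelled by phi. *)
Definition PGL25 (phi : 'I_6 -> proj_point) : {set 'S_6} :=
  [set s : 'S_6 | [exists g : {'GL_2(5)},
     [forall i : 'I_6, val (phi (s i)) == gl_image g (val (phi i))]]].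

Lemma PGL25_group_set (phi : 'I_6 -> proj_point) : group_set (PGL25 phi).
Proof.
apply/group_setP; split=> [|s t].
  rewrite inE; apply/existsP; exists 1; apply/forallP => i.
  rewrite perm1 /gl_image; apply/eqP.
  rewrite (_ : linfun _ = \1%VF) ?lim1g //.
  by apply/lfunP => v; rewrite !lfunE /= mul1mx.
rewrite !inE => /existsP[g /forallP gs] /existsP[h /forallP ht].
apply/existsP; exists (h * g); apply/forallP => i.
rewrite permM (eqP (ht _)) (eqP (gs _)) /gl_image -limg_comp; apply/eqP.
congr (_ @: _)%VS; apply/lfunP => v.
by rewrite comp_lfunE !lfunE /= mulmxA.
Qed.

Canonical PGL25_group (phi : 'I_6 -> proj_point) : {group 'S_6} :=
  Group (PGL25_group_set phi).

(* Main.v *)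
(* A matrix fixing three distinct projective points is scalar, so two distinct
   elements of PGL(2,5), or of one of its left or right cosets, agree on at most
   two letters. Vertices of the Star graph at distance 1 or 2 differ on at most
   three letters, so the radius-1 balls around the 120 code words are disjoint
   and, having 6 elements each, cover the 720 vertices. A vertex at distance 2
   from a code word is then adjacent to another one, which lies at distance 3
   from the first. *)
Require Import Defs.
From mathcomp Require Import all_boot all_order all_fingroup all_algebra.

Set Implicit Arguments.
Unset Strict Implicit.
Unset Printing Implicit Defensive.

Import GroupScope GRing.Theory.

(** * Sphere packing in a regular graph *)

Section Packing.
Variables (V : finType) (e : rel V) (k : nat) (C : {set V}).
Hypotheses (e_sym : symmetric e) (e_irr : irreflexive e).
Hypothesis e_reg : regular_graph e k.
Hypothesis C_dist1 : {in C &, forall x y, x != y -> ~~ e x y}.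
Hypothesis C_dist2 :
  {in C &, forall x y, x != y -> forall z, ~~ (e x z && e z y)}.
Hypothesis C_large : (#|V| <= k.+1 * #|C|)%N.

(** Collecting the code words near a vertex turns disjointness of the radius-1 balls into
    [#|ball v| <= 1], and exact covering into [#|ball v| = 1]. *)
Let ball v := [set c in C | (v == c) || e c v].

Lemma packing_ball_le1 v : (#|ball v| <= 1)%N.
Proof.
apply/card_le1P => c; rewrite inE => /andP[Cc cv] d.
rewrite [d \in ball v]inE [RHS]inE.
have [-> |dc] := eqVneq d c; first by rewrite Cc cv.
apply/negP => /andP[Cd dv]; case/orP: cv dv => [/eqP-> | cv].
  by rewrite eq_sym (negPf dc) (negPf (C_dist1 Cd Cc dc)).
case/orP=> [/eqP vd | dv].
  by move: (C_dist1 Cc Cd); rewrite eq_sym dc -vd cv => /(_ isT).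
by move: (C_dist2 Cd Cc dc v); rewrite dv e_sym cv.
Qed.

(** Double counting: a code word covers itself and its [k] neighbours, and irreflexivity keeps it
    from being counted twice. *)
Lemma sum_card_ball : (\sum_v #|ball v| = k.+1 * #|C|)%N.
Proof.
transitivity (\sum_v \sum_(c in C) ((v == c) || e c v : nat))%N.
  apply: eq_bigr => v _; rewrite -sum1_card big_mkcond [RHS]big_mkcond /=.
  by apply: eq_bigr => c _; rewrite inE; case: (c \in C); case: (_ || _).
rewrite exchange_big /= mulnC -sum_nat_const; apply: eq_bigr => c Cc.
rewrite -big_mkcond sum1_card -(e_reg c) -add1n.
have := cardsU1 c [set y | e c y]; rewrite inE e_irr /= => <-.
by apply: eq_card => v; rewrite !inE.
Qed.

(** A sum of [#|V|] terms, each at most 1, reaches [#|V|] only if every term is 1; [C_large] forces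
    this equality case. *)
Lemma packing_card : #|V| = (k.+1 * #|C|)%N /\ forall v, #|ball v| = 1%N.
Proof.
have le1 v (_ : true) : (#|ball v| <= 1 ?= iff (#|ball v| == 1))%N.
  by split=> //; apply: packing_ball_le1.
have := leqif_sum le1; rewrite sum_card_ball sum1_card.
case=> le_kC eq_kC.
have eqV : (k.+1 * #|C|)%N == #|V| by rewrite eqn_leq le_kC C_large.
split; first by rewrite (eqP eqV).
by move=> v; apply/eqP; move: v; apply/forallP; rewrite -eq_kC.
Qed.

(** The path from [c] through [m] to [z] serves to show that distance 3 is attained, not merely a
    lower bound. *)
Lemma packing_perfect c m z :
  c \in C -> e c m -> e m z -> c != z -> ~~ e c z -> perfect_code e C.
Proof.
move=> Cc cm mz cz ncz; have [cardV ball1] := packing_card.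
have path_ge3 x y (p : seq V) :
  x \in C -> y \in C -> x != y -> path e x p -> last x p = y -> (2 < size p)%N.
  move=> Cx Cy xy; case: p => [_ /= xy' | u [|v []]] //=.
  - by rewrite xy' eqxx in xy.
  - rewrite andbT => xu uy; rewrite -uy in Cy xy.
    by rewrite (negPf (C_dist1 Cx Cy xy)) in xu.
  - rewrite andbT => xuv vy; rewrite -vy in Cy xy.
    by rewrite (negPf (C_dist2 Cx Cy xy u)) in xuv.
(* [z] is covered, but it is no code word itself, being two steps from [c]; hence a neighbour covers
   it. *)
have [d Cd dz] : exists2 d, d \in C & e d z.
  have /card_gt0P[d] : (0 < #|ball z|)%N by rewrite ball1.
  rewrite inE => /andP[Cd /orP[/eqP zd|dz]]; last by exists d.
  by move: (C_dist2 Cc Cd); rewrite -zd cz => /(_ isT m); rewrite cm mz.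
have cd : c != d by apply: contraNneq ncz => ->.
exists k; split=> //.
- split=> [|x y d' Cx Cy xy [[p [xp py <-]] _]]; last exact: path_ge3 xp py.
  exists c, d; split=> //; split=> [|p cp pd]; last exact: path_ge3 cp pd.
  by exists [:: m; z; d]; rewrite /= cm mz e_sym dz.
- rewrite cardV natrM mulrC mulKf //.
  by rewrite Num.Theory.pnatr_eq0.
Qed.

End Packing.

(** * The Star graph and a Hamming-distance criterion for perfect codes *)

Section StarGraph.
Variable n : nat.
Implicit Types x y : 'S_n.+1.

Lemma star_generatorsE :
  star_generators n.+1 = [set tperm ord0 j | j in [set~ (ord0 : 'I_n.+1)]].
Proof.
apply/setP => s; apply/imset2P/imsetP => [[i j] | [j]].
  rewrite !inE => i0 j0 ->; exists j; rewrite ?inE //.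
  by congr tperm; apply: val_inj; apply/eqP.
by rewrite !inE => j0 ->; exists ord0 j; rewrite ?inE.
Qed.

Lemma star_graphP x y :
  reflect (exists2 j, j != ord0 & x = tperm ord0 j * y) (star_graph n.+1 x y).
Proof.
rewrite /star_graph /cayley_graph star_generatorsE.
apply: (iffP exists_inP) => [[_ /imsetP[j j0 ->] /eqP xy] | [j j0 xy]].
  by exists j; rewrite // !inE in j0 *.
by exists (tperm ord0 j); [apply: imset_f; rewrite !inE | apply/eqP].
Qed.

Lemma star_graph_sym : symmetric (star_graph n.+1).
Proof.
suff imp x y : star_graph n.+1 x y -> star_graph n.+1 y x.
  by move=> x y; apply/idP/idP; apply: imp.
case/star_graphP=> j j0 ->; apply/star_graphP.
by exists j; rewrite // mulgA tperm2 mul1g.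
Qed.

(** Generators are transpositions, so parity is a bipartition; this rules out loops and
    triangles. *)
Lemma odd_star_graph x y : star_graph n.+1 x y -> odd_perm x = ~~ odd_perm y.
Proof. by case/star_graphP=> j j0 ->; rewrite odd_mul_tperm eq_sym j0. Qed.

Lemma star_graph_regular : regular_graph (star_graph n.+1) n.
Proof.
move=> x; transitivity #|[set tperm ord0 j * x | j in [set~ (ord0 : 'I_n.+1)]]|.
  apply: eq_card => y; rewrite inE star_graph_sym.
  apply/star_graphP/imsetP => [] [j j0 ->].
    by exists j; rewrite ?inE.
  by exists j; rewrite // !inE in j0.
rewrite card_in_imset ?cardsC1 ?card_ord // => i j _ _ /mulIg eq_ij.
by rewrite -(tpermL ord0 i) eq_ij tpermL.
Qed.

(* An edge changes at most two values and a path of length two at most three,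
   the centre [ord0] being shared. *)
Lemma star_perfect_code (C : {set 'S_n.+1}) :
    (1 < n)%N ->
    {in C &, forall x y, x != y -> (3 < #|[set k | x k != y k]|)%N} ->
    ((n.+1)`! <= n.+1 * #|C|)%N ->
  perfect_code (star_graph n.+1) C.
Proof.
move=> n_gt1 C_ham C_large.
have small x y (A : {set 'I_n.+1}) :
    x \in C -> y \in C -> x != y ->
    (#|A| <= 3)%N -> (forall k, k \notin A -> x k = y k) -> False.
  move=> Cx Cy xy A3 xyA; have := C_ham x y Cx Cy xy.
  rewrite ltnNge => /negP[]; apply: leq_trans A3; apply: subset_leq_card.
  by apply/subsetP => k; rewrite inE; apply: contraNT => /xyA->.
have [c Cc] : exists c, c \in C.
  apply/set0Pn; rewrite -card_gt0; apply: contraLR C_large.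
  by rewrite -eqn0Ngt => /eqP->; rewrite muln0 -ltnNge fact_gt0.
(* Two letters other than the centre, available since [1 < n], give the path [c], [(0 1) c],
   [(0 2) (0 1) c]. *)
pose i1 : 'I_n.+1 := inord 1; pose i2 : 'I_n.+1 := inord 2.
have i1E : i1 = 1%N :> nat by rewrite inordK // ltnS ltnW.
have i2E : i2 = 2%N :> nat by rewrite inordK // ltnS.
have i10 : i1 != ord0 by rewrite -val_eqE /= i1E.
have i20 : i2 != ord0 by rewrite -val_eqE /= i2E.
have i12 : i1 != i2 by rewrite -val_eqE /= i1E i2E.
have cm : star_graph n.+1 c (tperm ord0 i1 * c).
  by rewrite star_graph_sym; apply/star_graphP; exists i1.
have mz : star_graph n.+1 (tperm ord0 i1 * c)
                     (tperm ord0 i2 * (tperm ord0 i1 * c)).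
  by rewrite star_graph_sym; apply/star_graphP; exists i2.
apply: packing_perfect (star_graph_regular) _ _ _ _ _ _ Cc cm mz _ _.
- exact: star_graph_sym.
- move=> x; case xx: (star_graph _ x x) => //.
  by move: (odd_star_graph xx); case: odd_perm.
- move=> x y Cx Cy xy; apply/star_graphP => -[j j0 eq_xy].
  apply: (small x y [set ord0; j]) => // [|k].
    by rewrite cards2 eq_sym j0.
  rewrite !inE negb_or => /andP[k0 kj].
  by rewrite eq_xy permM tpermD // eq_sym.
- move=> x y Cx Cy xy z.
  apply/andP => -[/star_graphP[i i0 xz] /star_graphP[j j0 zy]].
  apply: (small x y (i |: [set ord0; j])) => // [|k].
    by rewrite cardsU1 cards2 eq_sym j0; case: (_ \notin _).
  rewrite !inE !negb_or => /and3P[ki k0 kj].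
  by rewrite xz zy !permM !tpermD // eq_sym.
- by rewrite card_Sn.
(* At [ord0] the end of the path takes the value [c i2], which differs from [c ord0]. *)
- apply/eqP => /permP/(_ ord0); rewrite !permM tpermL tpermD // 1?eq_sym //.
  by move/perm_inj/eqP; rewrite eq_sym (negPf i20).
- case cz: (star_graph _ _ _) => //; move: (odd_star_graph cz).
  rewrite !odd_mul_tperm !(eq_sym ord0) i10 i20.
  by case: odd_perm.
Qed.

End StarGraph.

(** * The action of GL(2,5) on projective points *)

Section ProjectiveLine.
Local Open Scope ring_scope.
Implicit Types (g h : {'GL_2(5)}) (U : {vspace 'cV['F_5]_2}).

Lemma gl_imageM g h U : gl_image (g * h)%g U = gl_image g (gl_image h U).
Proof.
rewrite /gl_image -limg_comp; congr (_ @: _)%VS; apply/lfunP => v.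
by rewrite comp_lfunE !lfunE /= mulmxA.
Qed.

Lemma gl_image1 U : gl_image 1%g U = U.
Proof.
rewrite /gl_image (_ : linfun _ = \1%VF) ?lim1g //.
by apply/lfunP => v; rewrite !lfunE /= mul1mx.
Qed.

(** A linear image never raises dimension; applying this to [g] and to its inverse gives
    equality. *)
Lemma dim_gl_image g U : \dim (gl_image g U) = \dim U.
Proof.
suff le_dim h W : (\dim (gl_image h W) <= \dim W)%N.
  apply/eqP; rewrite eqn_leq le_dim /=.
  by rewrite -[X in (\dim X <= _)%N]gl_image1 -(mulVg g) gl_imageM le_dim.
by rewrite -(limg_ker_dim (linfun (mulmx (GLval h))) W) leq_addl.
Qed.

Lemma proj_point_line (P : proj_point) : exists u, val P = <[u]>%VS.
Proof.
case: P => U /= dimU; exists (vpick U).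
apply/esym/eqP; rewrite eqEdim -memvE memv_pick (eqP dimU) dim_vline.
by rewrite vpick0 -dimv_eq0 (eqP dimU).
Qed.

Lemma proj_point_add (P Q : proj_point) : P != Q -> (val P + val Q = fullv)%VS.
Proof.
move=> PQ; apply/eqP; rewrite eqEdim subvf dimvf dim_matrix /=.
have PsubPQ : (val P <= val P + val Q)%VS := addvSl _ _.
have := dimvS PsubPQ; rewrite (eqP (valP P)) leq_eqVlt => /orP[/eqP d1 | //].
have eqPQ : (val P == val P + val Q)%VS.
  by rewrite eqEdim PsubPQ -d1 (eqP (valP P)).
have QsubP : (val Q <= val P)%VS by rewrite (eqP eqPQ) addvSr.
have : val Q == val P by rewrite eqEdim QsubP (eqP (valP P)) (eqP (valP Q)).
by rewrite val_eqE eq_sym (negPf PQ).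
Qed.

Lemma gl_image_line g u :
  gl_image g <[u]>%VS = <[u]>%VS -> exists a, GLval g *m u = a *: u.
Proof.
rewrite /gl_image limg_line lfunE /= => gu.
by apply/vlineP; rewrite -gu memv_line.
Qed.

(* With g u = a u, g v = b v and w = x u + y v, where x and y are nonzero, a
   third eigenvector w forces a = b. *)
Lemma fix3_scalar g (P Q R : proj_point) :
    P != Q -> Q != R -> R != P ->
    gl_image g (val P) = val P -> gl_image g (val Q) = val Q ->
    gl_image g (val R) = val R ->
  exists a, GLval g = a%:M.
Proof.
move=> PQ QR RP.
have [u Pu] := proj_point_line P; have [v Qv] := proj_point_line Q.
have [w Rw] := proj_point_line R.
have full := proj_point_add PQ; rewrite Pu Qv in full.
rewrite Pu Qv Rw.
move=> /gl_image_line[a gu] /gl_image_line[b gv] /gl_image_line[c gw].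
have span t : exists x y, t = x *: u + y *: v.
  have : t \in (<[u]> + <[v]>)%VS by rewrite full memvf.
  by case/memv_addP=> _ /vlineP[x ->] [_ /vlineP[y ->] ->]; exists x, y.
have dimP1 (S : proj_point) : \dim (val S) = 1%N := eqP (valP S).
(* A nonzero coefficient would put one spanning vector on the line of the other, making the two
   points equal. *)
have indep x y : x *: u + y *: v = 0 -> x = 0 /\ y = 0.
  have two_lines s t (S T : proj_point) : S != T -> val S = <[s]>%VS ->
    val T = <[t]>%VS -> forall x' y', x' *: s + y' *: t = 0 -> x' = 0.
    move=> ST Ss Tt x' y' /eqP; rewrite addr_eq0 => /eqP st.
    apply/eqP; apply: contraR ST => x'0; rewrite -val_eqE Ss Tt.
    rewrite eqEdim -Ss -Tt !dimP1 leqnn andbT Ss Tt -memvE.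
    by rewrite -[s](scalerK x'0) st -scaleNr !memvZ ?memv_line.
  move=> xy; split; first exact: two_lines PQ Pu Qv x y xy.
  have QP : Q != P by rewrite eq_sym.
  by rewrite addrC in xy; apply: two_lines QP Qv Pu y x xy.
have [x [y wE]] := span w.
have line_eq z (S : proj_point) t : val S = <[t]>%VS -> w = z *: t -> S = R.
  move=> St wz; apply/val_inj/esym/eqP.
  by rewrite eqEdim !dimP1 leqnn andbT St Rw -memvE wz memvZ ?memv_line.
have x0 : x != 0.
  apply: contraNneq QR => x0.
  by apply/eqP/(line_eq y _ _ Qv); rewrite wE x0 scale0r add0r.
have y0 : y != 0.
  apply: contraNneq RP => y0.
  by apply/eqP/esym/(line_eq x _ _ Pu); rewrite wE y0 scale0r addr0.
(* Expand [g w - c w = 0] in the basis [u], [v]. *)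
have [xac ybc] : x * (a - c) = 0 /\ y * (b - c) = 0.
  apply: indep; have := gw; rewrite wE mulmxDr -!scalemxAr gu gv => /eqP.
  rewrite -subr_eq0 => /eqP <-.
  rewrite scalerDr !scalerA !mulrBr !scalerBl opprD addrACA.
  by rewrite ![c * _]mulrC.
have ac : a = c.
  by apply/eqP; rewrite -subr_eq0; move/eqP: xac; rewrite mulf_eq0 (negPf x0).
have bc : b = c.
  by apply/eqP; rewrite -subr_eq0; move/eqP: ybc; rewrite mulf_eq0 (negPf y0).
exists c; have scal (t : 'cV_2) : GLval g *m t = c *: t.
  have [x' [y' ->]] := span t.
  by rewrite mulmxDr -!scalemxAr gu gv ac bc scalerDr !scalerA ![c * _]mulrC.
apply/matrixP => r s; have /colP/(_ r) := scal (delta_mx s 0).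
by rewrite -colE !mxE eqxx andbT mulr_natr.
Qed.

(** The matrix [h^-1 * g] fixes the three points, so it is scalar; the scalar is nonzero because [g]
    is invertible. *)
Lemma fix3_scale g h (P Q R : proj_point) :
    P != Q -> Q != R -> R != P ->
    gl_image g (val P) = gl_image h (val P) ->
    gl_image g (val Q) = gl_image h (val Q) ->
    gl_image g (val R) = gl_image h (val R) ->
  exists2 a, a != 0 & GLval g = a *: GLval h.
Proof.
move=> PQ QR RP ghP ghQ ghR.
have fix_hg U : gl_image g U = gl_image h U -> gl_image (h^-1 * g)%g U = U.
  by move=> ghU; rewrite gl_imageM ghU -gl_imageM mulVg gl_image1.
have [a ha] :=
  fix3_scalar PQ QR RP (fix_hg _ ghP) (fix_hg _ ghQ) (fix_hg _ ghR).
have ga : GLval g = a *: GLval h.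
  by rewrite -mul_mx_scalar -ha -GL_MxE mulKVg.
exists a => //; apply: contraTneq (GL_unit g) => a0.
by rewrite ga a0 scale0r unitr0.
Qed.

(** One inclusion suffices, since both images have the dimension of [U]. *)
Lemma gl_image_scale g h a U :
  a != 0 -> GLval g = a *: GLval h -> gl_image g U = gl_image h U.
Proof.
move=> a0 gh; apply/eqP; rewrite eqEdim !dim_gl_image leqnn andbT.
apply/subvP => _ /memv_imgP[u Uu ->]; rewrite lfunE /= gh -scalemxAl memvZ //.
have := memv_img (linfun (mulmx (GLval h : 'M['F_5]_2))) Uu.
by rewrite lfunE.
Qed.

End ProjectiveLine.

(** * PGL(2,5) and its cosets as codes *)

Section PGL.
Variables (phi : 'I_6 -> proj_point) (phi_bij : bijective phi).

Lemma PGL25P (s : 'S_6) :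
  reflect (exists g : {'GL_2(5)},
             forall i, val (phi (s i)) = gl_image g (val (phi i)))
          (s \in PGL25 phi).
Proof.
rewrite inE; apply: (iffP existsP) => -[g gs]; exists g.
  by move=> i; apply/eqP/(forallP gs).
by apply/forallP => i; apply/eqP.
Qed.

Lemma PGL25_hamming :
  {in PGL25 phi &, forall s t : 'S_6,
     s != t -> (3 < #|[set i | s i != t i]|)%N}.
Proof.
move=> s t /PGL25P[g gs] /PGL25P[h ht]; apply: contraNltn => small.
(* Of six letters, at most three disagreements leave at least three agreements. *)
have : (2 < #|[set i | s i == t i]|)%N.
  have := cardsC [set i | s i == t i]; rewrite card_ord => card6.
  have eqC : #|~: [set i | s i == t i]| = #|[set i | s i != t i]|.
    by apply: eq_card => i; rewrite !inE.
  rewrite ltnNge; apply/negP => agree2.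
  by have := leq_add agree2 small; rewrite -eqC card6.
case/card_gt2P=> i [j] [k] [[]]; rewrite !inE => /eqP sti /eqP stj /eqP stk.
case=> ij jk ki; have inj_phi := bij_inj phi_bij.
have [a a0 gh] : exists2 a, (a != 0)%R & GLval g = (a *: GLval h)%R.
  apply: (@fix3_scale g h (phi i) (phi j) (phi k));
    rewrite ?(inj_eq inj_phi) //.
  - by rewrite -gs -ht sti.
  - by rewrite -gs -ht stj.
  - by rewrite -gs -ht stk.
apply/eqP/permP => l; apply/inj_phi/val_inj.
by rewrite gs ht (gl_image_scale _ a0 gh).
Qed.

(** Ensures that every matrix is accounted for when [PGL25 phi] is counted through GL(2,5). *)
Lemma PGL25_induced (g : {'GL_2(5)}) :
  exists s : 'S_6, forall i, val (phi (s i)) = gl_image g (val (phi i)).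
Proof.
have [psi phiK psiK] := phi_bij.
have dim1 i : \dim (gl_image g (val (phi i))) == 1%N.
  by rewrite dim_gl_image (valP (phi i)).
pose f i := psi (Sub (gl_image g (val (phi i))) (dim1 i)).
have fE i : val (phi (f i)) = gl_image g (val (phi i)) by rewrite psiK SubK.
have f_inj : injective f.
  move=> i j fij; apply/(bij_inj phi_bij)/val_inj.
  rewrite -[LHS]gl_image1 -[RHS]gl_image1 -(mulVg g) !gl_imageM.
  by rewrite -!fE fij.
by exists (perm f_inj) => i; rewrite permE fE.
Qed.

(* Two matrices inducing the same permutation are proportional, so each of the
   480 elements of GL(2,5) shares its image with at most 3 others. *)
Lemma card_PGL25_ge : (120 <= #|PGL25 phi|)%N.
Proof.
pose ind (s : 'S_6) :=
  [set g : {'GL_2(5)} |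
     [forall i, val (phi (s i)) == gl_image g (val (phi i))]].
have card_ind s : (#|ind s| <= 4)%N.
  have [-> | [h]] := set_0Vmem (ind s); first by rewrite cards0.
  rewrite inE => /forallP hs.
  pose scal := [set (a *: GLval h)%R | a in [set~ (0 : 'F_5)%R]].
  have card4 : (#|scal| <= 4)%N.
    by apply: leq_trans (leq_imset_card _ _) _; rewrite cardsC1 card_Fp.
  apply: leq_trans card4; rewrite -(card_imset _ val_inj).
  apply/subset_leq_card/subsetP => _ /imsetP[g + ->].
  rewrite inE => /forallP gs.
  have inj_phi := bij_inj phi_bij.
  have [a a0 gh] : exists2 a, (a != 0)%R & GLval g = (a *: GLval h)%R.
    have gh i : gl_image g (val (phi i)) = gl_image h (val (phi i)).
      by rewrite -(eqP (gs i)) -(eqP (hs i)).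
    apply: (@fix3_scale g h (phi (inord 0)) (phi (inord 1)) (phi (inord 2)));
      rewrite ?gh //.
    - by rewrite (inj_eq inj_phi) -val_eqE /= !inordK.
    - by rewrite (inj_eq inj_phi) -val_eqE /= !inordK.
    - by rewrite (inj_eq inj_phi) -val_eqE /= !inordK.
  by apply/imsetP; exists a; rewrite ?inE.
(* The order is (25 - 1)(25 - 5). *)
have card480 : #|{: {'GL_2(5)}}| = 480.
  by rewrite -cardsT card_GL_2 card_Fp.
rewrite -(leq_pmul2r (isT : 0 < 4)%N) -[(120 * 4)%N]card480.
have cover : [set: {'GL_2(5)}] \subset \bigcup_(s in PGL25 phi) ind s.
  apply/subsetP => g _; have [s gs] := PGL25_induced g.
  apply/bigcupP; exists s; first by apply/PGL25P; exists g.
  by rewrite inE; apply/forallP => i; apply/eqP.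
rewrite -cardsT (leq_trans (subset_leq_card cover)) //.
rewrite -sum_nat_const; elim/big_rec2: _ => [|s m A _ leAm].
  by rewrite cards0.
by rewrite (leq_trans (leq_card_setU _ _)) // leq_add.
Qed.

(** In [x * s] the factor [x] acts first, so the set of disagreements is replaced by its preimage
    under [x], of the same size. *)
Lemma PGL25_lcoset_perfect x : perfect_code (star_graph 6) (x *: PGL25 phi).
Proof.
apply: star_perfect_code => // [s t|]; last first.
  (* Here [6!] is read as [6 * 120]. *)
  by rewrite card_lcoset (leq_mul2l 6 120) card_PGL25_ge.
case/lcosetP=> s' Gs' -> /lcosetP[t' Gt' ->].
rewrite (inj_eq (mulgI x)) => /(PGL25_hamming Gs' Gt').
rewrite -(card_preimset _ (@perm_inj _ x)); congr (_ < _)%N.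
by apply: eq_card => i; rewrite !inE !permM.
Qed.

(** In [s * x] the factor [x] acts last, so by injectivity the set of disagreements is unchanged. *)
Lemma PGL25_rcoset_perfect x : perfect_code (star_graph 6) (PGL25 phi :* x).
Proof.
apply: star_perfect_code => // [s t|]; last first.
  by rewrite card_rcoset (leq_mul2l 6 120) card_PGL25_ge.
case/rcosetP=> s' Gs' -> /rcosetP[t' Gt' ->].
rewrite (inj_eq (mulIg x)) => /(PGL25_hamming Gs' Gt').
by congr (_ < _)%N; apply: eq_card => i; rewrite !inE !permM (inj_eq perm_inj).
Qed.

End PGL.

(** Left cosets are the classes of the relation [y \in x *: H]; [equivalence_partition] cuts each
    class down to [G], which changes nothing as [H] lies in [G]. *)
Lemma lcosets_partition (gT : finGroupType) (G H : {group gT}) :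
  H \subset G -> partition (lcosets H G) G.
Proof.
move=> sHG.
suff <- : equivalence_partition [rel x y | y \in x *: H] G = lcosets H G.
  apply/equivalence_partitionP => x y z _ _ _ /=; rewrite lcoset_refl.
  by split=> // /lcoset_eqP->.
apply: eq_in_imset => x Gx; apply/setP => y; rewrite inE lcosetE /=.
apply: andb_idl => /lcosetP[h Hh ->].
by rewrite groupM // (subsetP sHG).
Qed.

Theorem theorem2 (phi : 'I_6 -> proj_point) (phi_bij : bijective phi) :
  [/\ perfect_code (star_graph 6) (PGL25 phi),
      perfect_code_partition (star_graph 6) (lcosets (PGL25 phi) [set: 'S_6]) &
      perfect_code_partition (star_graph 6) (rcosets (PGL25 phi) [set: 'S_6])].
Proof.
split; first by rewrite -[PGL25 phi]mulg1; apply: PGL25_rcoset_perfect.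
- split=> [|_ /lcosetsP[x _ ->]]; last exact: PGL25_lcoset_perfect.
  exact: lcosets_partition (subsetT _).
- split=> [|_ /rcosetsP[x _ ->]]; last exact: PGL25_rcoset_perfect.
  exact: rcosets_partition (subsetT _).
Qed.
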